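(* Let $n\ge2$ and let $\mu\lessdot\lambda$ be $n$-cores with $t_{r,s}\,\mu=\lambda$ and $0<r<s$ (where $\overline r\neq\overline s$). Let $(d_i)_{i\in\mathbb Z}$ be the extended offset sequence of $\mu$. Then 1. $s-r<n$. 2. Each connected component of $\lambda/\mu$ is a ribbon with $s-r$ cells, in diagonals of residue $\overline r,\overline{r+1},\dots,\overline{s-1}$. 3. The components are translates of each other and their heads lie on consecutive diagonals of residue $\overline{s-1}$. 4. The skew shape $\lambda/\mu$ has $d_r-d_s$ components.
   Context: Affine symmetric group. $\overline a$ denotes the class of $a\in\mathbb Z$ in $\mathbb Z/n\mathbb Z$. $\tilde S_n$ is the group under composition of bijections $w:\mathbb Z\to\mathbb Z$ with $w(i+n)=w(i)+n$ for all $i$ and $\sum_{i=1}^n(w(i)-i)=0$. For $\overline r\ne\overline s$, $t_{r,s}\in\tilde S_n$ exchanges $r$ and $s$ and fixes all $i$ with $\overline i\notin\{\overline r,\overline s\}$; $s_i=t_{i,i+1}$ (depending only on $\overline i$) are the simple reflections and $\ell$ is the corresponding length. $\tilde S_n^0$ is the set of $w\in\tilde S_n$ with $w(1)<\dots<w(n)$. For $v,w\in\tilde S_n$, $v\lessdot w$ means $\ell(w)=\ell(v)+1$ and $w=vt$ for some reflection $t=t_{i,j}$. Partitions. The diagram of a partition $\lambda$ is the set of cells $(i,j)$ with $1\le j\le\lambda_i$, drawn in Cartesian (French) convention with row $i$ the $i$-th row from the bottom. The diagonal index of $(i,j)$ is $j-i$ and its residue is $\overline{j-i}$. $\tilde S_n$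 acts on partitions: $s_i\lambda$ is obtained from $\lambda$ by removing every removable cell of residue $\overline i$ and adding every addable cell of residue $\overline i$. The edge sequence $p(\lambda)=\cdots p_{-1}p_0p_1\cdots$ traces the border of $\lambda$ from northwest to southeast, a letter $1$ being a south step and a letter $0$ an east step, indexed so that some cell on the $i$-th diagonal is touched by the steps $p_{i-1}$ and $p_i$ (so the empty partition has $p_i=1$ for $i<0$ and $p_i=0$ for $i\ge0$). An $n$-ribbon is a skew diagram consisting of $n$ rookwise connected cells with distinct residues; an $n$-core is a partition from which no $n$-ribbon can be removed. For an $n$-core and $i\in\mathbb Z$, $d_i$ is the integer with $p_{i-1+n(d_i-1)}=1$ and $p_{i-1+nd_i}=0$; $(d_i)_{i\in\mathbb Z}$ is the extended offset sequence (it satisfies $d_{i-n}=d_i+1$). The map $\mathfrak c:\tilde S_n^0\to\{n\text{-cores}\}$, $w\mapsto w\cdot\varnothing$, is a bijection; for cores, $\mu\lessdot\lambda$ means $v\lessdot w$ where $\mathfrak c(v)=\mu$, $\mathfrak c(w)=\lambda$. A ribbon is a rookwise connected skew diagram with all cells on distinct diagonals; components of $\lambda/\mu$ are the rookwise connected components; the head of a ribbon is its southeastmost cell. Consecutive diagonals of a given residue are diagonals whose indices are successive integers in that residue class mod $n$. *)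

(* Defs.v *)
From HB Require Import structures.
From mathcomp Require Import all_boot all_order all_algebra.
From mathcomp Require Import finmap zify.

Set Implicit Arguments.
Unset Strict Implicit.
Unset Printing Implicit Defensive.

Import Order.TTheory GRing.Theory Num.Theory.
Local Open Scope ring_scope.

(* Elements of the affine symmetric group are functions on int, compared by =1. *)

Definition affine_perm (n : nat) (w : int -> int) : Prop :=
  [/\ bijective w,
      forall i, w (i + n%:Z) = w i + n%:Z
    & \sum_(1 <= i < n.+1) (w i%:Z - i%:Z) = 0].

(* By periodicity, an affine permutation that exchanges r and s also exchanges
   r + k n and s + k n for every k. Meaningful when r, s are distinct mod n. *)
Definition reflection (n : nat) (r s : int) (i : int) : int :=
  if (i == r %[mod n])%Z then i + (s - r)
  else if (i == s %[mod n])%Z then i + (r - s)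
  else i.

Definition simple_refl (n : nat) (i : int) : int -> int := reflection n i (i + 1).

Definition word_prod (n : nat) (u : seq int) : int -> int :=
  foldr (fun i w => simple_refl n i \o w) id u.

Definition has_length (n : nat) (w : int -> int) (l : nat) : Prop :=
  (exists2 u, word_prod n u =1 w & size u = l) /\
  (forall u, word_prod n u =1 w -> (l <= size u)%N).

Definition bruhat_cover (n : nat) (v w : int -> int) : Prop :=
  [/\ affine_perm n v, affine_perm n w,
      exists2 l, has_length n v l & has_length n w l.+1
    & exists i j : int, (i != j %[mod n])%Z /\ w =1 v \o reflection n i j].

Definition grassmannian (n : nat) (w : int -> int) : Prop :=
  affine_perm n w /\
  forall i j : int, 1 <= i -> i < j -> j <= n%:Z -> w i < w j.

Record intpart := IntPart {
  parts :> seq nat;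
  partsP : sorted geq parts && (0%N \notin parts) }.

HB.instance Definition _ := [isSub for parts].
HB.instance Definition _ := [Equality of intpart by <:].

Definition empty_part : intpart := @IntPart [::] isT.

(* Rows and columns are numbered from 0: the cell (i, j) here is the cell
   (i + 1, j + 1) in the usual numbering, and the diagonal index is the same.
   Row 0 is the bottom row (French convention). *)
Definition cell := (nat * nat)%type.

Definition row_len (la : intpart) (i : nat) : nat := nth 0%N la i.

Definition diagram (la : intpart) : {fset cell} :=
  [fset c in [seq (i, j) | i <- iota 0 (size la), j <- iota 0 (row_len la i)]]%fset.

Definition diag (c : cell) : int := c.2%:Z - c.1%:Z.

Lemma size_row_len (la : intpart) i : (size la <= i)%N -> row_len la i = 0%N.
Proof. by move=> h; rewrite /row_len nth_default. Qed.

Lemma row_len_gt0 (la : intpart) i : (0 < row_len la i)%N = (i < size la)%N.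
Proof.
case: (ltnP i (size la)) => [h|/size_row_len -> //].
rewrite lt0n; apply/eqP => h0; case/andP: (partsP la) => _ /negP; apply.
by rewrite -h0; apply: mem_nth.
Qed.

Lemma row_len_le (la : intpart) i j : (i <= j)%N -> (row_len la j <= row_len la i)%N.
Proof.
move=> hij; case: (ltnP j (size la)) => [hj|/size_row_len -> //].
case/andP: (partsP la) => hs _.
have tr : transitive geq by move=> x y z /= h1 h2; apply: leq_trans h2 h1.
have rf : reflexive geq by move=> x /=.
by apply: (sorted_leq_nth tr rf 0%N hs) => //; rewrite !inE; lia.
Qed.

Lemma in_diagram (la : intpart) (c : cell) :
  (c \in diagram la) = (c.2 < row_len la c.1)%N.
Proof.
case: c => i j /=; rewrite !inE; apply/allpairsPdep/idP => /=.
  by case=> a [b []]; rewrite !mem_iota => _ + [-> ->].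
by move=> h; exists i, j; rewrite !mem_iota /= add0n -row_len_gt0; split=> //; lia.
Qed.

Lemma intpart_of_rows (f : nat -> nat) (N : nat) :
  (forall a, f a.+1 <= f a)%N -> f N = 0%N ->
  exists la : intpart, forall a, row_len la a = f a.
Proof.
elim: N f => [|N IH] f hf h0.
  exists empty_part => a; rewrite /row_len nth_nil; elim: a => [//|a IHa].
  by apply/esym/eqP; rewrite -leqn0 IHa hf.
case: (IH (fun a => f a.+1)) => [a|//|la hla]; first exact: hf.
case: (posnP (f 0%N)) => hf0.
  exists empty_part => a; rewrite /row_len nth_nil; elim: a => [//|a IHa].
  by apply/esym/eqP; rewrite -leqn0 IHa hf.
have hP : sorted geq (f 0%N :: la) && (0%N \notin f 0%N :: la).
  case/andP: (partsP la) => hs hn; rewrite inE negb_or hn andbT.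
  apply/andP; split; last by rewrite eq_sym -lt0n.
  case E: (la : seq nat) hs => [//|x s] /= ->; rewrite andbT.
  by have := hf 0%N; rewrite -hla /row_len E.
by exists (IntPart hP); case=> [//|a]; rewrite -hla.
Qed.

Definition removable (la : intpart) (c : cell) : bool :=
  [&& c \in diagram la, (c.1.+1, c.2) \notin diagram la
    & (c.1, c.2.+1) \notin diagram la].

Definition addable (la : intpart) (c : cell) : bool :=
  [&& c \notin diagram la,
      (c.1 == 0%N) || ((c.1.-1, c.2) \in diagram la)
    & (c.2 == 0%N) || ((c.1, c.2.-1) \in diagram la)].

(* The partition nu is s_i la. *)
Definition simple_act (n : nat) (i : int) (la nu : intpart) : Prop :=
  forall c : cell, (c \in diagram nu) =
    (c \in diagram la) && ~~ (removable la c && (diag c == i %[mod n])%Z)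
    || addable la c && (diag c == i %[mod n])%Z.

Lemma simple_act_exists (n : nat) (i : int) (la : intpart) :
  (1 < n)%N -> exists nu, simple_act n i la nu.
Proof.
move=> n1.
pose ad a := addable la (a, row_len la a) && (diag (a, row_len la a) == i %[mod n])%Z.
pose rm a := removable la (a, (row_len la a).-1)
             && (diag (a, (row_len la a).-1) == i %[mod n])%Z.
have adE a : addable la (a, row_len la a) =
    (a == 0%N) || (row_len la a < row_len la a.-1)%N.
  by rewrite /addable !in_diagram /= ltnn /=; lia.
have rmE a : removable la (a, (row_len la a).-1) = (row_len la a.+1 < row_len la a)%N.
  by rewrite /removable !in_diagram /=; have := row_len_le la (leqnSn a); lia.
have excl a : ad a -> rm a -> False.
  rewrite /ad /rm adE rmE /diag /= => /andP[_ h1] /andP[hr h2].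
  move: h1; rewrite -(eqP h2) eqz_mod_dvd.
  have -> : (row_len la a)%:Z - a%:Z - ((row_len la a).-1%:Z - a%:Z) = 1 by lia.
  by rewrite dvdz1 /=; lia.
pose f a := (row_len la a + ad a - rm a)%N.
have hf a : (f a.+1 <= f a)%N.
  rewrite /f; case: (ltngtP (row_len la a.+1) (row_len la a)) => h.
  - case E1: (ad a.+1); case E2: (rm a) => /=; try lia.
    suff : (row_len la a.+1).+1 != row_len la a by lia.
    apply/eqP => e; move: E1 E2; rewrite /ad /rm -e /diag /=.
    move=> /andP[_ h1] /andP[_ h2]; move: h2; rewrite -(eqP h1) eqz_mod_dvd.
    have -> : (row_len la a.+1)%:Z - a%:Z - ((row_len la a.+1)%:Z - a.+1%:Z) = 1 by lia.
    by rewrite dvdz1 /=; lia.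
  - by have := row_len_le la (leqnSn a); lia.
  - have -> : rm a = false by rewrite /rm rmE h ltnn.
    have -> : ad a.+1 = false by rewrite /ad adE /= h ltnn.
    by lia.
have fN : f (size la).+1 = 0%N.
  rewrite /f /ad adE /= !size_row_len //; lia.
case: (intpart_of_rows hf fN) => nu hnu; exists nu => -[a b].
rewrite [in LHS]in_diagram hnu /f /=.
have addb : addable la (a, b) -> b = row_len la a.
  by rewrite /addable !in_diagram /=; lia.
have remb : removable la (a, b) -> b = (row_len la a).-1 /\ (0 < row_len la a)%N.
  by rewrite /removable !in_diagram /=; lia.
rewrite in_diagram /=.
case: (boolP (ad a)) => ha.
  have hr : rm a = false by apply/negP; apply: excl.
  rewrite hr.
  have -> : addable la (a, b) && (diag (a, b) == i %[mod n])%Z = (b == row_len la a).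
    apply/idP/eqP; first by case/andP => /addb.
    by move=> ->.
  have -> : removable la (a, b) && (diag (a, b) == i %[mod n])%Z = false.
    by apply/negP => /andP[h1 h2]; case: (remb h1) => e p; move: hr; rewrite /rm -e h1 h2.
  by lia.
have -> : addable la (a, b) && (diag (a, b) == i %[mod n])%Z = false.
  by apply/negP => /andP[h1 h2]; move: ha; rewrite /ad -(addb h1) h1 h2.
case: (boolP (rm a)) => hr.
  have p : (0 < row_len la a)%N by move: hr; rewrite /rm rmE; lia.
  have -> : removable la (a, b) && (diag (a, b) == i %[mod n])%Z = (b == (row_len la a).-1).
    apply/idP/eqP; first by case/andP => /remb[].
    by move=> ->.
  by lia.
have -> : removable la (a, b) && (diag (a, b) == i %[mod n])%Z = false.
  by apply/negP => /andP[h1 h2]; case: (remb h1) => e p; move: hr; rewrite /rm -e h1 h2.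
by lia.
Qed.

(* For the word u = i_1 ... i_k, the partition nu is s_{i_1} (... (s_{i_k} la)). *)
Fixpoint word_act (n : nat) (u : seq int) (la nu : intpart) : Prop :=
  if u is i :: u' then exists2 ka, word_act n u' la ka & simple_act n i ka nu
  else la = nu.

(* The partition nu is w la; it does not depend on the word chosen for w. *)
Definition acts (n : nat) (w : int -> int) (la nu : intpart) : Prop :=
  exists2 u, word_prod n u =1 w & word_act n u la nu.

(* The border goes through the points (x, y) with x the number of columns to
   the left and y the number of rows below, and the step p_k is the one that
   starts on x - y = k. The south step along the end of row i goes from
   (row_len la i, i + 1) to (row_len la i, i); the east step along the top of
   column j goes from (j, col_len la j) to (j + 1, col_len la j). *)
Definition edge (la : intpart) (k : int) : bool :=
  has (fun i => k == (row_len la i)%:Z - i.+1%:Z) (iota 0 (size la + `|k|%N)).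

Definition col_len (la : intpart) (j : nat) : nat := count (ltn j) la.

Lemma edgeP (la : intpart) (k : int) :
  reflect (exists i, k = (row_len la i)%:Z - i.+1%:Z) (edge la k).
Proof.
apply: (iffP hasP) => [[i _ /eqP ->]|[i hi]]; first by exists i.
exists i; last exact/eqP.
rewrite mem_iota /= add0n; case: (ltnP i (size la)) => h; first by lia.
by move: hi; rewrite size_row_len //; lia.
Qed.

Lemma ltn_col_len (la : intpart) (i j : nat) :
  (i < col_len la j)%N = (j < row_len la i)%N.
Proof.
rewrite /col_len /row_len; case: la => s /= /andP[hs _].
elim: s i hs => [|x s IH] i hs /=; first by rewrite nth_nil.
have hs' : sorted geq s by apply: path_sorted hs.
have tr : transitive geq by move=> a b c /= h1 h2; apply: leq_trans h2 h1.
case: (ltnP j x) => hx.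
  by case: i => [|i] /=; rewrite ?hx // add1n ltnS IH.
have hall : all (fun y => y <= x)%N s by apply: order_path_min hs.
have -> : count (ltn j) s = 0%N.
  apply/eqP; rewrite -leqn0 leqNgt -has_count; apply/hasPn => y /(allP hall) /=; lia.
case: i => [|i] /=; first by lia.
case: (ltnP i (size s)) => hi; last by rewrite nth_default.
have /= := allP hall _ (mem_nth 0%N hi); lia.
Qed.

Lemma edgePn (la : intpart) (k : int) :
  reflect (exists j, k = j%:Z - (col_len la j)%:Z) (~~ edge la k).
Proof.
apply: (iffP idP) => [hk|[j hj]]; last first.
  apply/edgeP => -[i hi]; have := ltn_col_len la i j.
  by case: ltnP => h1; case: ltnP => h2 //; lia.
have ex : exists i, (row_len la i)%:Z - i.+1%:Z < k.
  by exists (size la + `|k|%N)%N; rewrite size_row_len; lia.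
have [i hi hmin] := ex_minnP ex.
have hj : 0 <= k + i%:Z by lia.
exists (absz (k + i%:Z)).
suff -> : col_len la (absz (k + i%:Z)) = i by lia.
apply/eqP; rewrite eqn_leq; apply/andP; split.
  by rewrite leqNgt ltn_col_len; lia.
case: i hi hmin hj => [//|i] hi hmin hj; rewrite ltn_col_len.
have h1 : ~~ ((row_len la i)%:Z - i.+1%:Z < k).
  by apply/negP => /hmin; lia.
have h2 : k <> (row_len la i)%:Z - i.+1%:Z.
  by move=> e; case/edgeP: hk; exists i.
by lia.
Qed.

Definition extended_offset (n : nat) (la : intpart) (d : int -> int) : Prop :=
  forall i : int, edge la (i - 1 + n%:Z * (d i - 1)) = true
               /\ edge la (i - 1 + n%:Z * d i) = false.

Definition included (mu la : intpart) : Prop := {subset diagram mu <= diagram la}.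

Definition skew_shape (la mu : intpart) : {fset cell} := (diagram la `\` diagram mu)%fset.

Definition skew_diagram (S : {fset cell}) : Prop :=
  exists la mu, included mu la /\ S = skew_shape la mu.

Definition rook_adj (c c' : cell) : bool :=
  (`|c.1%:Z - c'.1%:Z|%N + `|c.2%:Z - c'.2%:Z|%N == 1)%N.

Definition rook_rel (S : {fset cell}) : rel S :=
  fun x y => rook_adj (val x) (val y).

Definition components (S : {fset cell}) : {fset {fset cell}} :=
  [fset [fset val y | y : S & connect (@rook_rel S) x y] | x : S]%fset.

Definition rookwise_connected (S : {fset cell}) : Prop :=
  forall x y : S, connect (@rook_rel S) x y.

Definition ribbon (S : {fset cell}) : Prop :=
  [/\ skew_diagram S, rookwise_connected S & {in S &, injective diag}].

Definition n_ribbon (n : nat) (S : {fset cell}) : Prop :=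
  [/\ skew_diagram S, #|` S| = n, rookwise_connected S
    & {in S &, forall c c', (diag c = diag c' %[mod n])%Z -> c = c'}].

Definition n_core (n : nat) (la : intpart) : Prop :=
  forall mu, included mu la -> ~ n_ribbon n (skew_shape la mu).

Definition core_cover (n : nat) (mu la : intpart) : Prop :=
  exists v w,
    [/\ grassmannian n v, grassmannian n w, acts n v empty_part mu,
        acts n w empty_part la & bruhat_cover n v w].

(* The southeastmost cell, rows being numbered upwards. *)
Definition is_head (C : {fset cell}) (h : cell) : Prop :=
  h \in C /\ forall c, c \in C -> (h.1 <= c.1)%N /\ (c.2 <= h.2)%N.

Definition occupies (C : {fset cell}) (x y : int) : Prop :=
  exists2 c, c \in C & x = c.1%:Z /\ y = c.2%:Z.

Definition translates (C C' : {fset cell}) : Prop :=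
  exists a b : int, forall x y, occupies C x y <-> occupies C' (x + a) (y + b).

(* The set X consists of m successive integers of the class of a mod n. *)
Definition consecutive_in_class (n : nat) (a : int) (m : nat) (X : int -> Prop) : Prop :=
  exists2 e : int, (e = a %[mod n])%Z &
    forall x : int, X x <-> exists2 k : nat, (k < m)%N & x = e + n%:Z * k%:Z.

(* Main.v *)
Require Import Defs.
From mathcomp Require Import all_boot all_order all_algebra.
From mathcomp Require Import finmap zify.

Import Order.TTheory GRing.Theory Num.Theory.
Local Open Scope ring_scope.

(** An affine permutation acts on a partition by permuting the steps of its edge
    sequence ([edge_acts]), so [la] arises from [mu] by exchanging the steps at
    [r + nk - 1] and [s + nk - 1] for all [k]. By the definition of offsets, the
    first step goes south for [k < d_r] and the second one for [k < d_s]
    ([edge_offset]), so something changes only for [k] between [d_s] and [d_r].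

    The covering condition enters through three consequences for offsets
    ([cover_offsets]): [d_s < d_r], [s - r < n], and no index strictly between
    [r] and [s] has an offset strictly between [d_s] and [d_r]. They come from
    the strong exchange property of words in the simple reflections
    ([exchange]). It shows that multiplying by a reflection whose two values are
    in increasing order strictly raises the length; if one of the consequences
    failed, the reflection would lower the length, or factor into three such
    ascents ([cover_gap], [cover_narrow]), or contradict that a minimal coset
    representative increases on windows.

    The inequality [d_s < d_r] says that every exchanged pair consists of a south
    step at [r + nk - 1] and an east step at [s + nk - 1], for [d_s <= k < d_r].
    Exchanging them adds one cell on each diagonal from [r + nk] to
    [s + nk - 1] ([exit_row_strip]). These cells follow the border of [mu], so
    they form a ribbon with [s - r] cells. As [s - r < n], at least one empty
    diagonal separates two of these ribbons, so they are the components
    ([componentsP]), and there are [d_r - d_s] of them. The condition on the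
    offsets between [r] and [s] says that the steps of [mu] strictly inside the
    strips do not depend on [k], so the ribbons are translates of each other
    ([piece_rows]). *)

(** * Congruences and affine reflections *)

Lemma eqmodzP (n : nat) (x y : int) :
  reflect (exists k : int, x = y + n%:Z * k) (x == y %[mod n])%Z.
Proof.
rewrite eqz_mod_dvd; apply: (iffP dvdzP) => -[k hk]; exists k; lia.
Qed.

Lemma eqmodz_shift (n : nat) (x y k : int) :
  (x + n%:Z * k == y %[mod n])%Z = (x == y %[mod n])%Z.
Proof. by rewrite mulrC addrC modzMDl. Qed.

Lemma eqmodz_shiftr (n : nat) (x y k : int) :
  (y == x + n%:Z * k %[mod n])%Z = (y == x %[mod n])%Z.
Proof. by rewrite eq_sym eqmodz_shift eq_sym. Qed.

(** Lets linear arithmetic finish once two multiples of [n] are known to be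
    close. *)
Lemma mulz_near (n : nat) (j k : int) :
  n%:Z * j < n%:Z * k + n%:Z -> n%:Z * k < n%:Z * j + n%:Z -> j = k.
Proof. by nia. Qed.

Variant reflection_spec (n : nat) (r s : int) : int -> int -> Prop :=
| ReflectionL k : reflection_spec n r s (r + n%:Z * k) (s + n%:Z * k)
| ReflectionR k : reflection_spec n r s (s + n%:Z * k) (r + n%:Z * k)
| ReflectionN x of (x != r %[mod n])%Z & (x != s %[mod n])%Z :
    reflection_spec n r s x x.

Lemma reflectionP (n : nat) (r s x : int) :
  reflection_spec n r s x (reflection n r s x).
Proof.
rewrite /reflection; case: ifPn => [/eqmodzP[k ->]|hr].
  by rewrite [X in reflection_spec _ _ _ _ X](_ : _ = s + n%:Z * k); [constructor|lia].
case: ifPn => [/eqmodzP[k ->]|hs]; last by constructor.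
by rewrite [X in reflection_spec _ _ _ _ X](_ : _ = r + n%:Z * k); [constructor|lia].
Qed.

Lemma reflection_left (n : nat) (r s k : int) :
  reflection n r s (r + n%:Z * k) = s + n%:Z * k.
Proof. by rewrite /reflection eqmodz_shift eqxx; lia. Qed.

Lemma reflection_right (n : nat) (r s k : int) : (r != s %[mod n])%Z ->
  reflection n r s (s + n%:Z * k) = r + n%:Z * k.
Proof.
by move=> h; rewrite /reflection !eqmodz_shift eqxx eq_sym (negPf h); lia.
Qed.

Lemma reflection_fix (n : nat) (r s x : int) :
  (x != r %[mod n])%Z -> (x != s %[mod n])%Z -> reflection n r s x = x.
Proof. by rewrite /reflection => /negPf-> /negPf->. Qed.

Lemma reflection_l (n : nat) (r s : int) : reflection n r s r = s.
Proof. by have := reflection_left n r s 0; rewrite mulr0 !addr0. Qed.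

Lemma reflection_r (n : nat) (r s : int) : (r != s %[mod n])%Z ->
  reflection n r s s = r.
Proof. by move=> /(reflection_right n r s 0); rewrite mulr0 !addr0. Qed.

Lemma reflectionD (n : nat) (r s x k : int) :
  reflection n r s (x + n%:Z * k) = reflection n r s x + n%:Z * k.
Proof. by rewrite /reflection !eqmodz_shift; case: ifP => _; [|case: ifP]; lia. Qed.

Lemma reflection_shift (n : nat) (r s k x : int) :
  reflection n (r + n%:Z * k) (s + n%:Z * k) x = reflection n r s x.
Proof. by rewrite /reflection !eqmodz_shiftr; case: ifP => _; [|case: ifP]; lia. Qed.

Lemma reflectionC (n : nat) (r s x : int) : (r != s %[mod n])%Z ->
  reflection n r s x = reflection n s r x.
Proof.
move=> h; case: (reflectionP n r s x) => [k|k|y hr hs].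
- by rewrite reflection_right // eq_sym.
- by rewrite reflection_left.
- by rewrite reflection_fix.
Qed.

Lemma reflectionK (n : nat) (r s : int) : (r != s %[mod n])%Z ->
  involutive (reflection n r s).
Proof.
move=> h x; case: (reflectionP n r s x) => [k|k|y hr hs].
- exact: reflection_right.
- exact: reflection_left.
- exact: reflection_fix.
Qed.

Lemma reflection_inj (n : nat) (r s : int) : (r != s %[mod n])%Z ->
  injective (reflection n r s).
Proof. by move=> /reflectionK/inv_inj. Qed.

Definition periodic (n : nat) (f : int -> int) : Prop :=
  forall x k, f (x + n%:Z * k) = f x + n%:Z * k.

Lemma periodicP (n : nat) (f : int -> int) :
  (forall x, f (x + n%:Z) = f x + n%:Z) -> periodic n f.
Proof.
move=> hf; have hN m x : f (x + n%:Z * m%:Z) = f x + n%:Z * m%:Z.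
  elim: m => [|m IH]; first by rewrite mulr0 !addr0.
  have -> : x + n%:Z * m.+1%:Z = (x + n%:Z * m%:Z) + n%:Z by lia.
  by rewrite hf IH; lia.
move=> x k; case: (lerP 0 k) => hk.
  by have <- : (absz k)%:Z = k by lia.
have := hN (absz k) (x + n%:Z * k).
have -> : (absz k)%:Z = - k by lia.
by rewrite mulrN addrK => ->; rewrite subrK.
Qed.

Lemma periodic_mod (n : nat) (f : int -> int) (x y : int) :
  periodic n f -> injective f ->
  (f x == f y %[mod n])%Z = (x == y %[mod n])%Z.
Proof.
move=> pf injf; apply/eqmodzP/eqmodzP => -[k hk]; exists k.
  by apply: injf; rewrite pf.
by rewrite hk pf.
Qed.

(** Turns right multiplication by a reflection, which exchanges positions, into
    left multiplication by the reflection that exchanges the values there. *)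
Lemma reflection_conj (n : nat) (f : int -> int) (a b x : int) :
  periodic n f -> injective f ->
  f (reflection n a b x) = reflection n (f a) (f b) (f x).
Proof.
move=> pf injf; rewrite {2}/reflection !periodic_mod // /reflection.
case: ifPn => [/eqmodzP[k ->]|_].
  have -> : a + n%:Z * k + (b - a) = b + n%:Z * k by lia.
  by rewrite !pf; lia.
case: ifPn => // /eqmodzP[k ->].
have -> : b + n%:Z * k + (a - b) = a + n%:Z * k by lia.
by rewrite !pf; lia.
Qed.

Lemma simple_mod (n : nat) (i : int) : (1 < n)%N -> (i != i + 1 %[mod n])%Z.
Proof.
move=> n1; apply/negP => /eqmodzP[k hk].
have k0 : k = 0 by apply: (mulz_near n); lia.
by move: hk; rewrite k0; lia.
Qed.

Lemma word_prod_periodic (n : nat) (u : seq int) : periodic n (word_prod n u).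
Proof. by elim: u => [|i u IH] x k //=; rewrite IH /simple_refl reflectionD. Qed.

Lemma word_prod_inj (n : nat) (u : seq int) : (1 < n)%N ->
  injective (word_prod n u).
Proof.
move=> n1; elim: u => [|i u IH] x y //= h.
by apply/IH/(reflection_inj n _ _ (simple_mod n i n1) _ _ h).
Qed.

(** * The exchange property and covers *)

Lemma simple_refl_gt (n : nat) (i x y : int) : (1 < n)%N -> x < y ->
  simple_refl n i y < simple_refl n i x ->
  (x == i %[mod n])%Z /\ y = x + 1.
Proof.
move=> n1 hxy; rewrite /simple_refl {2}/reflection.
case: ifPn => [hx|hx]; first by rewrite /reflection; do 2?[case: ifP => _]; lia.
rewrite /reflection; case: ifP => hx2; first by do 2?[case: ifP => _]; lia.
do 2?[case: ifP => _]; lia.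
Qed.

(** The strong exchange property. Reading the word from right to left, the
    images of [a] and [b] start in increasing order and end in decreasing
    order, so some letter swaps them; these images are then two consecutive
    integers exchanged by that letter, and deleting the letter amounts to
    multiplying on the right by the reflection in [a] and [b]. *)
Lemma exchange (n : nat) (u : seq int) (a b : int) : (1 < n)%N -> a < b ->
  word_prod n u b < word_prod n u a ->
  exists2 u', (size u' < size u)%N &
    word_prod n u' =1 word_prod n u \o reflection n a b.
Proof.
move=> n1 hab; elim: u => [|i u IH] /=; first by lia.
case: (ltrP (word_prod n u b) (word_prod n u a)) => h.
  case: (IH h) => u' hs hu' _; exists (i :: u') => // x /=.
  by rewrite hu'.
move=> hi; have {}h : word_prod n u a < word_prod n u b.
  rewrite lt_neqAle h andbT; apply/eqP => /(word_prod_inj n u n1); lia.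
case: (simple_refl_gt _ _ _ _ n1 h hi) => /eqmodzP[k hk] hb.
exists u => // x /=; rewrite /comp /= reflection_conj; last first.
- exact: word_prod_inj.
- exact: word_prod_periodic.
rewrite hb hk -addrA [n%:Z * k + 1]addrC addrA reflection_shift.
by rewrite /simple_refl reflectionK // simple_mod.
Qed.

Definition length_le (n : nat) (w : int -> int) (l : nat) : Prop :=
  exists2 u, word_prod n u =1 w & (size u <= l)%N.

(** Multiplying on the right by a reflection in two points whose images are in
    increasing order raises the length: the exchange property shortens every
    word of the product to a word of the original. *)
Lemma length_ascent (n : nat) (v w : int -> int) (a b : int) (l : nat) :
  (1 < n)%N -> (a != b %[mod n])%Z -> w =1 v \o reflection n a b ->
  a < b -> v a < v b -> length_le n w l ->
  (0 < l)%N /\ length_le n v l.-1.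
Proof.
move=> n1 hmod hw hab hv [u hu hs].
have [|u' hs' hu'] := exchange n u a b n1 hab.
  by rewrite !hu !hw /= reflection_l reflection_r.
split; first by lia.
exists u'; last by lia.
by move=> x; rewrite hu' /= hu hw /= reflectionK.
Qed.

(** Every ascent costs at least one letter, so three of them do not fit in a
    length difference of one. *)
Lemma no_triple_ascent (n : nat) (v w : int -> int) (l : nat)
    (a b a' b' a'' b'' : int) :
  let v1 := v \o reflection n a b in
  let v2 := v1 \o reflection n a' b' in
  (1 < n)%N -> has_length n v l -> has_length n w l.+1 ->
  w =1 v2 \o reflection n a'' b'' ->
  [/\ (a != b %[mod n])%Z, a < b & v a < v b] ->
  [/\ (a' != b' %[mod n])%Z, a' < b' & v1 a' < v1 b'] ->
  [/\ (a'' != b'' %[mod n])%Z, a'' < b'' & v2 a'' < v2 b''] -> False.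
Proof.
move=> v1 v2 n1 [_ vmin] [[u hu hsu] _] hw [? ? h1] [? ? h2] [? ? h3].
have lw : length_le n w l.+1 by exists u => //; rewrite hsu.
have [_ l2] := length_ascent n v2 w a'' b'' _ n1 ltac:(done) hw ltac:(done) h3 lw.
have [_ l1] := length_ascent n v1 v2 a' b' _ n1 ltac:(done) (frefl v2) ltac:(done) h2 l2.
have [l_gt0 [u0 hu0]] :=
  length_ascent n v v1 a b _ n1 ltac:(done) (frefl v1) ltac:(done) h1 l1.
by have := vmin u0 hu0; move: l_gt0; rewrite /=; lia.
Qed.

(** With the values in decreasing order, the exchange property would make [w]
    shorter than [v]. *)
Lemma cover_ascent (n : nat) (v w : int -> int) (l : nat) (a b : int) :
  (1 < n)%N -> has_length n v l -> has_length n w l.+1 -> injective v ->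
  (a != b %[mod n])%Z -> w =1 v \o reflection n a b -> a < b -> v a < v b.
Proof.
move=> n1 [[u hu hsu] _] [_ wmin] injv hmod hw hab.
rewrite ltNge le_eqVlt; apply/negP => /orP[/eqP/injv|hv]; first by lia.
have [|u' hs hu'] := exchange n u a b n1 hab; first by rewrite !hu.
suff /wmin : word_prod n u' =1 w by lia.
by move=> x; rewrite hu' hw /= hu.
Qed.

(** If a third point lay between the exchanged points both in position and in
    value, the pattern 123 would become 321 through the three ascents 213, 231
    and 321, against the difference of lengths. *)
Lemma cover_gap (n : nat) (v w : int -> int) (l : nat) (a b c : int) :
  (1 < n)%N -> has_length n v l -> has_length n w l.+1 ->
  (a != b %[mod n])%Z -> w =1 v \o reflection n a b ->
  (c != a %[mod n])%Z -> (c != b %[mod n])%Z ->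
  a < c < b -> v a < v c < v b -> False.
Proof.
move=> n1 lv lw hab hw hca hcb /andP[ac cb] /andP[vac vcb].
have hac : (a != c %[mod n])%Z by rewrite eq_sym.
have hbc : (b != c %[mod n])%Z by rewrite eq_sym.
have hba : (b != a %[mod n])%Z by rewrite eq_sym.
apply: (no_triple_ascent n v w l a c c b a c n1 lv lw) => //=.
- move=> x /=; rewrite hw /= (reflection_conj n (reflection n a c)).
  + by rewrite reflection_r // (reflection_fix _ _ _ b) // reflectionK.
  + by move=> y k; apply: reflectionD.
  + exact: reflection_inj.
- by split=> //; rewrite reflection_r // (reflection_fix _ _ _ b) //; lia.
- split=> //; rewrite reflection_l (reflection_fix _ c b a) // reflection_l.
  by rewrite (reflection_fix _ a c b).
Qed.

(** Points more than [n] apart both in position and in value are exchanged by a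
    reflection that factors into three ascents inside the infinite dihedral
    group of the two residue classes. Let [n k] be the largest multiple of [n]
    below both differences and let [t_j] be the reflection in [a] and
    [b + n j]. If the difference in position is the smaller one, then
    [t_0 = t_{-k} t_{-2k} t_{-k}] works; otherwise [t_0 = t_{-k} t_0 t_k]
    does. *)
Lemma cover_narrow (n : nat) (v w : int -> int) (l : nat) (a b : int) :
  (1 < n)%N -> has_length n v l -> has_length n w l.+1 ->
  periodic n v -> injective v ->
  (a != b %[mod n])%Z -> w =1 v \o reflection n a b ->
  n%:Z < b - a -> n%:Z < v b - v a -> False.
Proof.
move=> n1 lv lw pv injv hab hw hpos hval.
have hba : (b != a %[mod n])%Z by rewrite eq_sym.
(* The disjunction expresses that [k] is maximal: [2k] overshoots the smaller
   difference. *)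
have [k [k_gt0 hposk hvalk hk]] : exists k : int,
    [/\ 0 < k, n%:Z * k < b - a, n%:Z * k < v b - v a
      & b - a < n%:Z * k + n%:Z * k \/ v b - v a < n%:Z * k + n%:Z * k].
  pose m := Num.min (b - a) (v b - v a).
  pose k := (m %/ n)%Z.
  have [k_gt0 hk hk2] : [/\ 0 < k, n%:Z * k <= m & m < n%:Z * k + n%:Z].
    have n0 : n%:Z != 0 by lia.
    have := divz_eq m n; have := modz_ge0 m n0; have := @ltz_pmod m n.
    rewrite -/k => hlt hge heq; have {}hlt := hlt ltac:(lia).
    have : n%:Z < m by rewrite /m; lia.
    have -> : m = n%:Z * k + (m %% n)%Z by lia.
    move=> hm; split; [|lia|lia].
    by rewrite ltNge; apply/negP => hk0; nia.
  have hposk : n%:Z * k != b - a.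
    apply/eqP => e; move: hba.
    by rewrite (_ : b = a + n%:Z * k) ?eqmodz_shift ?eqxx //; lia.
  have hvalk : n%:Z * k != v b - v a.
    apply/eqP => e; move: hba; rewrite -(periodic_mod n v) //.
    by rewrite (_ : v b = v a + n%:Z * k) ?eqmodz_shift ?eqxx //; lia.
  have hnk : n%:Z <= n%:Z * k by nia.
  exists k; move: (k) k_gt0 hnk hk hk2 hposk hvalk => {}k k_gt0 hnk.
  by rewrite /m; split; lia.
have hmod j : (a != b + n%:Z * j %[mod n])%Z by rewrite eqmodz_shiftr.
have tD r s x j : reflection n r s (x + n%:Z * j) = reflection n r s x + n%:Z * j.
  exact: reflectionD.
have tk_a : reflection n a (b + n%:Z * (- k)) a = b + n%:Z * (- k).
  exact: reflection_l.
have tk_b : reflection n a (b + n%:Z * (- k)) b = a + n%:Z * k.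
  by rewrite -{2}(subrK (n%:Z * k) b) -mulrN tD reflection_r.
have t0_a : reflection n a b a = b by exact: reflection_l.
have t0_b : reflection n a b b = a by exact: reflection_r.
case: hk => hk.
  pose c := b + n%:Z * (- k - k).
  have hca : (c != a %[mod n])%Z by rewrite eq_sym; apply: hmod.
  have t2_a : reflection n c a a = c by exact: reflection_r.
  have t2_b : reflection n c a (b + n%:Z * (- k)) = a + n%:Z * k.
    have -> : b + n%:Z * (- k) = c + n%:Z * k by lia.
    by rewrite tD reflection_l.
  apply: (no_triple_ascent n v w l
    a (b + n%:Z * (- k)) c a a (b + n%:Z * (- k)) n1 lv lw).
  - move=> x /=; rewrite hw /= (reflection_conj n (reflection n a _)); last first.
    + exact: reflection_inj.
    + by move=> y j; apply: reflectionD.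
    rewrite reflectionK // tD tk_b tk_a.
    have -> : a + n%:Z * k + n%:Z * (- k - k) = a + n%:Z * (- k) by lia.
    by rewrite reflection_shift.
  - by rewrite pv; split=> //; lia.
  - by split=> //=; [lia | rewrite tD tk_b tk_a !pv; lia].
  - split=> //=; first by lia.
    by rewrite t2_a t2_b !tD tk_a tk_b !pv; lia.
apply: (no_triple_ascent n v w l
  a (b + n%:Z * (- k)) a b a (b + n%:Z * k) n1 lv lw).
- move=> x /=; rewrite hw /= (reflection_conj n (reflection n a b)); last first.
  + exact: reflection_inj.
  + by move=> y j; apply: reflectionD.
  rewrite tD t0_a t0_b (reflectionC n b) ?eqmodz_shiftr //.
  have -> y : reflection n (a + n%:Z * k) b y = reflection n a (b + n%:Z * (- k)) y.
    by rewrite -(reflection_shift n a _ k) (_ : b + _ + _ = b) //; lia.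
  by rewrite reflectionK.
- by rewrite pv; split=> //; lia.
- by split=> //=; [lia | rewrite tk_b tk_a !pv; lia].
- split=> //=; first by lia.
  by rewrite tD t0_a t0_b !tD tk_a tk_b !pv; lia.
Qed.

(** * Edge sequences and diagrams *)

Lemma exit_row_subproof (la : intpart) (k : int) :
  exists i : nat, (row_len la i)%:Z - i%:Z <= k.
Proof. by exists (size la + `|k|)%N; rewrite size_row_len; lia. Qed.

(** The row in which the diagonal [k] leaves the diagram, which is also the
    number of south steps [p_m] with [m >= k]. *)
Definition exit_row (la : intpart) (k : int) : nat :=
  ex_minn (exit_row_subproof la k).

Lemma ltn_exit_row (la : intpart) (k : int) (i : nat) :
  (i < exit_row la k)%N = (k < (row_len la i)%:Z - i%:Z).
Proof.
rewrite /exit_row; case: ex_minnP => m hm hmin; apply/idP/idP => h.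
  by rewrite ltNge; apply/negP => /hmin; lia.
by rewrite ltnNge; apply/negP => hmi; have := row_len_le la hmi; lia.
Qed.

Lemma exit_rowS (la : intpart) (k : int) :
  exit_row la k = (exit_row la (k + 1) + edge la k)%N.
Proof.
have hle i j : (i <= j)%N -> (row_len la j <= row_len la i)%N by apply: row_len_le.
set m := exit_row la (k + 1).
have hm i : (i < m)%N = (k + 1 < (row_len la i)%:Z - i%:Z) by rewrite ltn_exit_row.
have hk i : (i < exit_row la k)%N = (k < (row_len la i)%:Z - i%:Z).
  by rewrite ltn_exit_row.
have := hm m; rewrite ltnn => /esym/negbT hmm.
case: edgeP => [[i hi]|he] /=.
  have := hm i; have := hk i.+1; have := hle i i.+1 (leqnSn i).
  have := hk i; have := hm i.-1; have := hle i.-1 i (leq_pred i); lia.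
have := hk m; suff : k + 1 != (row_len la m)%:Z - m%:Z.
  by have := hk m.-1; have := hm m.-1; lia.
by apply/eqP => e; apply: he; exists m; lia.
Qed.

Lemma exit_row_far (la : intpart) (k : int) :
  (row_len la 0)%:Z <= k -> exit_row la k = 0%N.
Proof. by have := ltn_exit_row la k 0; lia. Qed.

Lemma exit_row_ge (la : intpart) (k : int) : 0 <= (exit_row la k)%:Z + k.
Proof. by have := ltn_exit_row la k (exit_row la k); rewrite ltnn; lia. Qed.

Lemma in_diagram_exit (la : intpart) (c : cell) :
  (c \in diagram la) = (c.1 < exit_row la (diag c))%N.
Proof. by rewrite in_diagram ltn_exit_row /diag; lia. Qed.

Lemma exit_row_unique (la : intpart) (k : int) (m : nat) : 0 <= m%:Z + k ->
  (forall c, diag c = k -> (c \in diagram la) = (c.1 < m)%N) ->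
  exit_row la k = m.
Proof.
move=> hm hc; have hE := exit_row_ge la k.
have hin i : 0 <= i%:Z + k -> (i < exit_row la k)%N = (i < m)%N.
  move=> hi; have hd : diag (i, absz (i%:Z + k)) = k by rewrite /diag /=; lia.
  by rewrite -(hc _ hd) in_diagram_exit hd.
by have := hin _ hm; have := hin _ hE; lia.
Qed.

(** A cell of the diagonal [k] is addable where the step [p_(k-1)] goes south and
    [p_k] goes east, and removable where they come in the other order; in both
    cases the action exchanges these two steps. With the steps read at [x - 1],
    the exchanged indices are exactly those of [s_i = t_{i, i+1}]. The proof
    tracks where each diagonal leaves the diagram: this row changes only on the
    diagonals of residue [i], whose neighbours have other residues. *)
Lemma edge_simple_act (n : nat) (i : int) (la nu : intpart) (x : int) :
  (1 < n)%N -> simple_act n i la nu ->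
  edge nu (simple_refl n i x - 1) = edge la (x - 1).
Proof.
move=> n1 hact.
have off k : (k != i %[mod n])%Z -> exit_row nu k = exit_row la k.
  move=> hk; apply: exit_row_unique; first exact: exit_row_ge.
  by move=> c hc; rewrite hact in_diagram_exit hc (negPf hk) !andbF orbF andbT.
have on k : (k == i %[mod n])%Z ->
    (exit_row nu k + exit_row la k = exit_row la (k - 1) + exit_row la (k + 1))%N.
  move=> hk; have := exit_rowS la k; have := exit_rowS la (k - 1).
  rewrite subrK => h1 h2; have hge := exit_row_ge la k.
  have hge1 := exit_row_ge la (k + 1).
  suff -> : exit_row nu k = (exit_row la (k + 1) + edge la (k - 1))%N by lia.
  apply: exit_row_unique.
    by have := exit_row_ge la (k - 1); move: h1 h2; case: (edge la (k - 1)); lia.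
  move=> c hc; rewrite hact /removable /addable hc hk !andbT !in_diagram_exit /=.
  have du : diag (c.1.+1, c.2) = k - 1 by rewrite -hc /diag /=; lia.
  have dr : diag (c.1, c.2.+1) = k + 1 by rewrite -hc /diag /=; lia.
  rewrite du dr hc.
  have -> : (c.1 == 0)%N || (c.1.-1 < exit_row la (diag (c.1.-1, c.2)))%N =
      (c.1 <= exit_row la (k + 1))%N.
    case: c hc {du dr} => -[|a] b hc //=; have -> // : diag (a, b) = k + 1.
    by rewrite -hc /diag /=; lia.
  have -> : (c.2 == 0)%N || (c.1 < exit_row la (diag (c.1, c.2.-1)))%N =
      (c.1 < exit_row la (k - 1))%N.
    case: c hc {du dr} => a [|b] hc /=.
      have := exit_row_ge la (k - 1); move: hc; rewrite /diag /=; lia.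
    by have -> // : diag (a, b) = k - 1; rewrite -hc /diag /=; lia.
  move: h1 h2; case: (edge la k); case: (edge la (k - 1)); lia.
have sh j : (x == j + 1 %[mod n])%Z = (x - 1 == j %[mod n])%Z.
  by rewrite !eqz_mod_dvd opprD addrA addrAC.
have near j : (j == i %[mod n])%Z -> (j + 1 != i %[mod n])%Z.
  move=> /eqmodzP[k hk]; apply/negP => /eqmodzP[k' hk'].
  have e0 : k' = k by apply: (mulz_near n); lia.
  by move: hk'; rewrite e0; lia.
have nearN j : (j == i %[mod n])%Z -> (j - 1 != i %[mod n])%Z.
  move=> /eqmodzP[k hk]; apply/negP => /eqmodzP[k' hk'].
  have e0 : k' = k by apply: (mulz_near n); lia.
  by move: hk'; rewrite e0; lia.
rewrite /simple_refl /reflection; case: ifPn => [hx|hx].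
  have -> : x + (i + 1 - i) - 1 = x by lia.
  have := on _ hx; have := off _ (near _ hx).
  have := exit_rowS nu x; have := exit_rowS la (x - 1); rewrite subrK.
  by case: (edge nu x); case: (edge la (x - 1)); lia.
case: ifPn; rewrite sh => hx1.
  have -> : x + (i - (i + 1)) - 1 = x - 1 - 1 by lia.
  have := on _ hx1; have := off _ (nearN _ hx1).
  have := exit_rowS nu (x - 1 - 1); have := exit_rowS la (x - 1).
  rewrite !subrK.
  by case: (edge nu (x - 1 - 1)); case: (edge la (x - 1)); lia.
have := off _ hx; have := off _ hx1.
have := exit_rowS nu (x - 1); have := exit_rowS la (x - 1); rewrite subrK.
by case: (edge nu (x - 1)); case: (edge la (x - 1)); lia.
Qed.

Lemma edge_word_act (n : nat) (u : seq int) (la nu : intpart) (x : int) :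
  (1 < n)%N -> word_act n u la nu ->
  edge nu (word_prod n u x - 1) = edge la (x - 1).
Proof.
move=> n1; elim: u nu => [|i u IH] nu /=; first by move=> ->.
by case=> ka /IH <-; apply: edge_simple_act.
Qed.

Lemma edge_acts (n : nat) (w : int -> int) (la nu : intpart) (x : int) :
  (1 < n)%N -> acts n w la nu -> edge nu (w x - 1) = edge la (x - 1).
Proof. by move=> n1 [u <-]; apply: edge_word_act. Qed.

Lemma edge_empty (k : int) : edge empty_part k = (k < 0).
Proof.
apply/edgeP/idP => [[i ->]|hk]; first by rewrite /row_len nth_nil; lia.
by exists (absz (k + 1)); rewrite /row_len nth_nil; lia.
Qed.

(** * Covers in terms of offsets *)

(** The steps of [mu] are those of the empty partition transported by [v], so
    the step at [v y - 1] goes south exactly when [y <= 0]. The definition of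
    the offset then says that [c + n d_(v c)] lies in [1, ..., n]. *)
Lemma le0_offset (n : nat) (v : int -> int) (mu : intpart) (d : int -> int)
    (c k : int) :
  (1 < n)%N -> periodic n v -> acts n v empty_part mu -> extended_offset n mu d ->
  (c + n%:Z * k <= 0) = (k < d (v c)).
Proof.
move=> n1 pv hv hd.
have hE j : edge mu (v c - 1 + n%:Z * j) = (c + n%:Z * j <= 0).
  rewrite (_ : v c - 1 + n%:Z * j = v (c + n%:Z * j) - 1); last by rewrite pv; lia.
  by rewrite (edge_acts n v empty_part) // edge_empty; lia.
have [] := hd (v c); rewrite !hE => h1 /negbT h2.
apply/idP/idP => hk; last by nia.
by rewrite ltNge; apply/negP => hk'; nia.
Qed.

Lemma edge_offset (n : nat) (v : int -> int) (mu : intpart) (d : int -> int)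
    (i k : int) :
  (1 < n)%N -> affine_perm n v -> acts n v empty_part mu -> extended_offset n mu d ->
  edge mu (i - 1 + n%:Z * k) = (k < d i).
Proof.
move=> n1 [[v' _ vK] /periodicP pv _] hv hd.
rewrite -(vK i) -(le0_offset n v mu) //.
rewrite (_ : _ - 1 + _ = v (v' i + n%:Z * k) - 1); last by rewrite pv; lia.
by rewrite (edge_acts n v empty_part) // edge_empty; lia.
Qed.

(** Two points lie in the same window [kn + 1, ..., kn + n]. The encoding by
    signs is the form in which edge sequences see windows. *)
Definition same_window (n : nat) (x y : int) : Prop :=
  forall k : int, (x + n%:Z * k <= 0) = (y + n%:Z * k <= 0).

Lemma same_windowP (n : nat) (x y : int) : (0 < n)%N -> same_window n x y ->
  exists k : int, [/\ 1 <= x + n%:Z * k, x + n%:Z * k <= n%:Z,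
                      1 <= y + n%:Z * k & y + n%:Z * k <= n%:Z].
Proof.
move=> n0 hw; exists (- ((x - 1) %/ n)%Z).
have nz : n%:Z != 0 by lia.
have := divz_eq (x - 1) n; have := modz_ge0 (x - 1) nz.
have := @ltz_pmod (x - 1) n ltac:(lia).
have := hw (- ((x - 1) %/ n)%Z); have := hw (- ((x - 1) %/ n)%Z - 1).
by move: ((x - 1) %/ n)%Z ((x - 1) %% n)%Z => q e; split; lia.
Qed.

Lemma same_window_eq (n : nat) (x y : int) : (0 < n)%N ->
  same_window n x y -> (x == y %[mod n])%Z -> x = y.
Proof.
move=> n0 /same_windowP - /(_ n0) [k [h1 h2 h3 h4]] /eqmodzP[j hj].
have j0 : j = 0 by apply: (mulz_near n); lia.
by rewrite hj j0; lia.
Qed.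

(** Both permutations increase on every window, so no reflection inside a window
    can lead from one to the other. *)
Lemma grassmannian_window (n : nat) (v w : int -> int) (a b : int) :
  (1 < n)%N -> grassmannian n v -> grassmannian n w ->
  (a != b %[mod n])%Z -> w =1 v \o reflection n a b -> ~ same_window n a b.
Proof.
move=> n1 [[_ /periodicP pv _] vinc] [[_ /periodicP pw _] winc] hab hw hwin.
have [|k [ha1 ha2 hb1 hb2]] := same_windowP _ _ _ _ hwin; first by lia.
have wa : w (a + n%:Z * k) = v (b + n%:Z * k) by rewrite hw /= reflection_left.
have wb : w (b + n%:Z * k) = v (a + n%:Z * k) by rewrite hw /= reflection_right.
case: (ltgtP (a + n%:Z * k) (b + n%:Z * k)) => h.
- by have := vinc _ _ ha1 h hb2; have := winc _ _ ha1 h hb2; lia.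
- by have := vinc _ _ hb1 h ha2; have := winc _ _ hb1 h ha2; lia.
- by move: hab; rewrite (_ : a = b) ?eqxx //; lia.
Qed.

(** The action on a core only sees windows. It still identifies the reflection:
    a residue class that changes windows must be one of [a] and [b], and a point
    is determined by its window and its residue. *)
Lemma reflection_window_eq (n : nat) (a b i j : int) : (1 < n)%N ->
  (a != b %[mod n])%Z -> (i != j %[mod n])%Z -> ~ same_window n i j ->
  (forall x, (reflection n a b x <= 0) = (reflection n i j x <= 0)) ->
  reflection n i j =1 reflection n a b.
Proof.
move=> n1 hab hij hwin h.
have n0 : (0 < n)%N by lia.
have hW x : same_window n (reflection n a b x) (reflection n i j x).
  by move=> k; rewrite -!reflectionD h.
have shW x y k : same_window n (x + n%:Z * k) (y + n%:Z * k) -> same_window n x y.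
  move=> hs m; have := hs (m - k).
  have e z : z + n%:Z * k + n%:Z * (m - k) = z + n%:Z * m by lia.
  by rewrite !e.
have hi : (i == a %[mod n])%Z || (i == b %[mod n])%Z.
  apply: contraT; rewrite negb_or => /andP[hia hib]; case: hwin.
  by have := hW i; rewrite reflection_l reflection_fix.
have hj : (j == a %[mod n])%Z || (j == b %[mod n])%Z.
  apply: contraT; rewrite negb_or => /andP[hja hjb]; case: hwin => k; symmetry; move: k.
  by have := hW j; rewrite reflection_r // reflection_fix.
move=> x; symmetry; apply: (same_window_eq n _ _ n0 (hW x)).
case/orP: hi => hi; case/orP: hj => hj.
- by case/negP: hij; rewrite (eqP hi) (eqP hj).
- rewrite /reflection (eqP hi) (eqP hj).
  move/eqmodzP: hi => [k ->]; move/eqmodzP: hj => [m ->].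
  case: ifP => _; last case: ifP => _ //.
    have -> : x + (b + n%:Z * m - (a + n%:Z * k)) = x + (b - a) + n%:Z * (m - k) by lia.
    by rewrite eqmodz_shiftr.
  have -> : x + (a + n%:Z * k - (b + n%:Z * m)) = x + (a - b) + n%:Z * (k - m) by lia.
  by rewrite eqmodz_shiftr.
- rewrite (reflectionC n a) // /reflection (eqP hi) (eqP hj).
  move/eqmodzP: hi => [k ->]; move/eqmodzP: hj => [m ->].
  case: ifP => _; last case: ifP => _ //.
    have -> : x + (a + n%:Z * m - (b + n%:Z * k)) = x + (a - b) + n%:Z * (m - k) by lia.
    by rewrite eqmodz_shiftr.
  have -> : x + (b + n%:Z * k - (a + n%:Z * m)) = x + (b - a) + n%:Z * (k - m) by lia.
  by rewrite eqmodz_shiftr.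
by case/negP: hij; rewrite (eqP hi) (eqP hj).
Qed.

(** Let [a] and [b] be the preimages of [r] and [s] under [v]. The reflection
    that witnesses the cover is the one in [a] and [b], because it acts in the
    same way on [mu]. The covering condition then forces [a < b], hence
    [d_s < d_r], and a value between [r] and [s] must have its preimage outside
    the interval from [a] to [b], hence an offset outside the interval from
    [d_s] to [d_r]. If [s - r] exceeded [n], then [b - a < n]; this puts [b]
    before [a + n] in one window, where [v] increases, so [s < r + n]. *)
Lemma cover_offsets (n : nat) (mu la : intpart) (r s : int) (d : int -> int) :
  (1 < n)%N -> core_cover n mu la -> (r != s %[mod n])%Z -> r < s ->
  acts n (reflection n r s) mu la -> extended_offset n mu d ->
  [/\ s - r < n%:Z, d s < d r,
      forall i, r < i < s -> d r <= d i \/ d i <= d s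
    & forall i k, edge mu (i - 1 + n%:Z * k) = (k < d i)].
Proof.
move=> n1 [v [w [gv gw av aw [Av _ [l lv lw] [i [j [hij hw]]]]]]] hrs r_lt_s hact hd.
have [[v' v'K vK] /periodicP pv _] := Av.
have injv := can_inj v'K.
pose a := v' r; pose b := v' s.
have va : v a = r by exact: vK.
have vb : v b = s by exact: vK.
have hab : (a != b %[mod n])%Z by rewrite -(periodic_mod n v) // va vb.
have {hij} hw' : w =1 v \o reflection n a b.
  have hT : reflection n i j =1 reflection n a b.
    apply: reflection_window_eq => //; first exact: (grassmannian_window n v w).
    move=> x.
    have e1 : edge la (v x - 1) = (reflection n a b x <= 0).
      rewrite -{1}(reflectionK n a b hab x) (reflection_conj n v) // va vb.
      by rewrite (edge_acts n _ mu) // (edge_acts n v empty_part) // edge_empty; lia.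
    rewrite -e1 -{1}(reflectionK n i j hij x) -[v _](hw (reflection n i j x)).
    by rewrite (edge_acts n w empty_part) // edge_empty; lia.
  by move=> x; rewrite hw /= hT.
have hnw := grassmannian_window n v w a b n1 gv gw hab hw'.
have a_lt_b : a < b.
  rewrite ltNge le_eqVlt; apply/negP => /orP[/eqP e|b_lt_a].
    by move: r_lt_s; rewrite -va -vb e ltxx.
  have : v b < v a.
    apply: (cover_ascent n v w l) => //; first by rewrite eq_sym.
    by move=> x; rewrite hw' /= reflectionC.
  by rewrite va vb; lia.
have hle c k : (c + n%:Z * k <= 0) = (k < d (v c)) by apply: (le0_offset n v mu).
have dsr : d s < d r.
  rewrite lt_neqAle; apply/andP; split.
    by apply/eqP => e; apply: hnw => k; rewrite !hle va vb e.
  have h1 := hle b (d s - 1); have h2 := hle a (d s - 1); move: h1 h2.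
  by rewrite va vb; lia.
have hsr : s - r < n%:Z.
  have hne : s - r != n%:Z.
    apply/eqP => e; case/negP: hrs; rewrite eq_sym.
    rewrite (_ : s = r + n%:Z * 1) ?eqmodz_shift //.
    by lia.
  rewrite ltNge le_eqVlt eq_sym (negPf hne) /=; apply/negP => hlong.
  case: (lerP (b - a) n) => hshort; last first.
    by apply: (cover_narrow n v w l a b); rewrite ?va ?vb.
  have hba : b < a + n%:Z.
    suff : b != a + n%:Z by lia.
    apply/eqP => e; case/negP: hab; rewrite eq_sym.
    rewrite (_ : b = a + n%:Z * 1) ?eqmodz_shift //.
    by rewrite e mulr1.
  have [h1 h2] : n%:Z * (d s - 1) + b <= 0 /\ 0 < b + n%:Z * d s.
    by have := hle b (d s - 1); have := hle b (d s); rewrite vb; lia.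
  have h3 : a + n%:Z * d s <= 0 by rewrite hle va.
  (* Here [0 < b + n d_s <= n]; the bound on [b - a] leaves no room for [a] in
     that window, so [a] lies in the previous one. *)
  have [_ vinc] := gv.
  have := vinc (b + n%:Z * d s) (a + n%:Z * (d s + 1)).
  by rewrite !pv va vb; lia.
split=> // [c /andP[rc cs]|c k]; last exact: (edge_offset n v).
pose x := v' c; have vx : v x = c by exact: vK.
have hx : ~~ (a < x < b).
  apply/negP => hx; apply: (cover_gap n v w l a b x) => //.
  - rewrite -(periodic_mod n v) // va vx; apply/negP => /eqmodzP[k hk].
    have k0 : k = 0 by apply: (mulz_near n); lia.
    by move: hk; rewrite k0; lia.
  - rewrite -(periodic_mod n v) // vb vx; apply/negP => /eqmodzP[k hk].
    have k0 : k = 0 by apply: (mulz_near n); lia.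
    by move: hk; rewrite k0; lia.
  - by rewrite va vb vx rc.
case: (lerP x a) => hxa; [left|right].
  by have := hle a (d r - 1); have := hle x (d r - 1); rewrite va vx; lia.
by have := hle b (d c - 1); have := hle x (d c - 1); rewrite vb vx; lia.
Qed.

(** * Skew shapes and their components *)

Lemma rook_adjC c c' : rook_adj c c' = rook_adj c' c.
Proof. by rewrite /rook_adj; lia. Qed.

Lemma rook_adj_diag c c' : rook_adj c c' ->
  diag c' = diag c + 1 \/ diag c = diag c' + 1.
Proof. by rewrite /rook_adj /diag; lia. Qed.

Lemma rook_rel_sym (A : {fset cell}) : connect_sym (@rook_rel A).
Proof. by apply: sym_connect_sym => x y; rewrite /rook_rel rook_adjC. Qed.

Lemma card_fset_iota (T : choiceType) (f : nat -> T) (m : nat) :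
  (forall i j, (i < m)%N -> (j < m)%N -> f i = f j -> i = j) ->
  #|` [fset f i | i in iota 0 m]%fset| = m.
Proof.
move=> finj; rewrite card_in_imfset /=; last first.
  by move=> i j; rewrite !mem_iota => im jm; apply: finj.
by rewrite undup_id ?iota_uniq ?size_iota.
Qed.

Lemma downset_threshold (P : pred nat) (m : nat) :
  (forall j, P j.+1 -> P j) -> ~~ P m -> {t | forall j, P j = (j < t)%N}.
Proof.
move=> hP hm; have ex : exists j, ~~ P j by exists m.
exists (ex_minn ex) => j; case: ex_minnP => t ht tmin; case: ltnP => hj.
  by apply: contraTT hj => /tmin; rewrite -leqNgt.
apply/negbTE; apply: contra ht; elim: j hj => [|j IH]; first by rewrite leqn0 => /eqP->.
by rewrite leq_eqVlt => /orP[/eqP-> //|/IH h /hP].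
Qed.

(** A union of components of a skew shape is again a skew diagram: added to the
    inner partition it gives a partition, since a cell of the shape just below
    or to the left of one of its cells belongs to the same component. *)
Lemma skew_diagram_adj_closed (la mu : intpart) (C : {fset cell}) :
  included mu la -> {subset C <= skew_shape la mu} ->
  (forall c c', c \in C -> c' \in skew_shape la mu -> rook_adj c c' -> c' \in C) ->
  skew_diagram C.
Proof.
move=> hmu hC hadj; pose P c := (c \in diagram mu) || (c \in C).
have Pla c : P c -> c \in diagram la.
  by case/orP => [/hmu //|/hC]; rewrite in_fsetD => /andP[].
have down c c' : rook_adj c c' -> (c'.1 <= c.1)%N -> (c'.2 <= c.2)%N -> P c -> P c'.
  move=> hcc h1 h2 hc; rewrite /P; case: (boolP (c' \in diagram mu)) => //= hc'.
  case/orP: (hc) => hcm.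
    move: hc' hcm; rewrite !in_diagram -leqNgt => hc' hcm.
    by have := row_len_le mu h1; lia.
  apply: (hadj c) => //; rewrite in_fsetD hc' /=.
  move: (Pla c hc); rewrite !in_diagram => hcl.
  by have := row_len_le la h1; lia.
have th i : {t | forall j, P (i, j) = (j < t)%N}.
  apply: (@downset_threshold (fun j => P (i, j)) (row_len la i)) => [j|].
    by apply: down; rewrite /rook_adj /=; lia.
  by apply/negP => /Pla; rewrite in_diagram /= ltnn.
pose f i := sval (th i).
have fP c : P c = (c.2 < f c.1)%N by rewrite /f; case: (th c.1) => t /= <-; case: c.
have [|//|kappa hk] := @intpart_of_rows f (size la).
- move=> i; rewrite leqNgt; apply/negP => hi.
  have : P (i, f i) by apply: (down (i.+1, f i)); rewrite /rook_adj ?fP //=; lia.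
  by rewrite fP /= ltnn.
- apply/eqP; rewrite -leqn0 leqNgt; apply/negP => h.
  have /Pla : P (size la, 0%N) by rewrite fP.
  by rewrite in_diagram /= size_row_len.
have dk c : (c \in diagram kappa) = P c by rewrite in_diagram hk fP.
exists kappa, mu; split=> [c hc|]; first by rewrite dk /P hc.
apply/fsetP => c; rewrite in_fsetD dk /P; case: (boolP (c \in C)) => [/hC|_].
  by rewrite in_fsetD orbT => /andP[->].
by rewrite orbF andNb.
Qed.

(** * Exchanging steps along strips of diagonals *)

Section Strips.
(** For each [k] with [lo <= k < hi], the partition [la] is obtained from [mu] by
    exchanging the south step at [r + nk - 1] with the east step at
    [s + nk - 1], which adds a ribbon on the diagonals in between. *)
Context (n : nat) (mu la : intpart) (r s lo hi : int).
Context (n_gt0 : (0 < n)%N) (r_lt_s : r < s) (s_r_lt_n : s - r < n%:Z)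
  (lo_lt_hi : lo < hi).
Context (edge_r : forall k, lo <= k < hi ->
           edge mu (r - 1 + n%:Z * k) /\ ~~ edge la (r - 1 + n%:Z * k))
        (edge_s : forall k, lo <= k < hi ->
           ~~ edge mu (s - 1 + n%:Z * k) /\ edge la (s - 1 + n%:Z * k))
        (edge_other : forall x,
           (forall k, lo <= k < hi -> x <> r - 1 + n%:Z * k) ->
           (forall k, lo <= k < hi -> x <> s - 1 + n%:Z * k) ->
           edge la x = edge mu x)
        (edge_between : forall i k k', r < i < s -> lo <= k < hi -> lo <= k' < hi ->
           edge mu (i - 1 + n%:Z * k) = edge mu (i - 1 + n%:Z * k')).

Definition strip_index (x : int) : int := ((x - r) %/ n)%Z.

(** The diagonals [x] with [r + nk <= x < s + nk] for some [lo <= k < hi]. *)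
Definition in_strip (x : int) : bool :=
  (lo <= strip_index x < hi) && (x < s + n%:Z * strip_index x).

Lemma strip_indexP x k :
  r + n%:Z * k <= x -> x < r + n%:Z * k + n%:Z -> strip_index x = k.
Proof.
move=> h1 h2; rewrite /strip_index.
have nz : n%:Z != 0 by lia.
have := divz_eq (x - r) n; have := modz_ge0 (x - r) nz.
have := @ltz_pmod (x - r) n ltac:(lia) => m1 m2 m3.
by apply: (mulz_near n); lia.
Qed.

Lemma strip_index_bounds x :
  r + n%:Z * strip_index x <= x < r + n%:Z * strip_index x + n%:Z.
Proof.
rewrite /strip_index.
have nz : n%:Z != 0 by lia.
have := divz_eq (x - r) n; have := modz_ge0 (x - r) nz.
by have := @ltz_pmod (x - r) n ltac:(lia); lia.
Qed.

Lemma in_stripP x : reflect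
  (exists2 k, lo <= k < hi & r + n%:Z * k <= x < s + n%:Z * k) (in_strip x).
Proof.
apply: (iffP andP) => [[h1 h2]|[k hk hx]].
  by exists (strip_index x) => //; have := strip_index_bounds x; lia.
by have -> : strip_index x = k by [apply: strip_indexP; lia]; split; lia.
Qed.

Lemma edge_strip x : (edge la x + in_strip (x + 1) = edge mu x + in_strip x)%N.
Proof.
have bx := strip_index_bounds x; have bx1 := strip_index_bounds (x + 1).
have eR k : lo <= k < hi -> x = r - 1 + n%:Z * k ->
    [/\ edge mu x, ~~ edge la x, ~~ in_strip x & in_strip (x + 1)].
  move=> hk ex; have [h1 h2] := edge_r k hk; rewrite ex; split=> //.
    apply/in_stripP => -[j hj hx].
    have [jk|jk] : j < k \/ k <= j by lia.
      have : n%:Z * j + n%:Z <= n%:Z * k by nia.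
      by lia.
    have : n%:Z * k <= n%:Z * j by nia.
    by lia.
  by apply/in_stripP; exists k => //; lia.
have eS k : lo <= k < hi -> x = s - 1 + n%:Z * k ->
    [/\ ~~ edge mu x, edge la x, in_strip x & ~~ in_strip (x + 1)].
  move=> hk ex; have [h1 h2] := edge_s k hk; rewrite ex; split=> //.
    by apply/in_stripP; exists k => //; lia.
  apply/in_stripP => -[j hj hx].
  have [jk|jk] : j <= k \/ k < j by lia.
    have : n%:Z * j <= n%:Z * k by nia.
    by lia.
  have : n%:Z * k + n%:Z <= n%:Z * j by nia.
  by lia.
have same : in_strip x = in_strip (x + 1) -> edge la x = edge mu x.
  move=> hx; apply: edge_other => k hk e.
    by have [_ _] := eR k hk e; rewrite hx => /negPf->.
  by have [_ _] := eS k hk e; rewrite hx => ->.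
have [sx|sx] := boolP (in_strip x); have [sx1|sx1] := boolP (in_strip (x + 1)).
- by rewrite same // sx sx1.
- case/in_stripP: (sx) => k hk hxk; have ex : x = s - 1 + n%:Z * k.
    by apply: contraNeq sx1 => hx; apply/in_stripP; exists k => //; lia.
  by have [/negPf-> -> _ _] := eS k hk ex.
- case/in_stripP: (sx1) => k hk hxk; have ex : x = r - 1 + n%:Z * k.
    by apply: contraNeq sx => hx; apply/in_stripP; exists k => //; lia.
  by have [-> /negPf-> _ _] := eR k hk ex.
by rewrite same // (negPf sx) (negPf sx1).
Qed.

(** Counting south steps from the far southeast, where both partitions have none,
    each exchange adds one to the count exactly between the two steps. *)
Lemma exit_row_strip x : exit_row la x = (exit_row mu x + in_strip x)%N.
Proof.
pose B := Num.max (Num.max (row_len mu 0)%:Z (row_len la 0)%:Z) (s + n%:Z * hi).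
have far y : B <= y -> exit_row la y = (exit_row mu y + in_strip y)%N.
  move=> hy; rewrite !exit_row_far; [|rewrite /B in hy; lia..].
  suff /negPf -> : ~~ in_strip y by [].
  apply/in_stripP => -[k hk hky].
  have : n%:Z * k <= n%:Z * hi by nia.
  by rewrite /B in hy; lia.
suff H m y : B <= y + m%:Z -> exit_row la y = (exit_row mu y + in_strip y)%N.
  by apply: (H (absz (B - x))); lia.
elim: m y => [|m IH] y hy; first by apply: far; lia.
have := edge_strip y; rewrite (exit_rowS la) (exit_rowS mu) IH; last by lia.
by lia.
Qed.

(** The cell of the diagonal [x] just outside [mu]. *)
Definition border_cell (x : int) : cell :=
  (exit_row mu x, absz ((exit_row mu x)%:Z + x)).

Lemma diag_border_cell x : diag (border_cell x) = x.
Proof. by rewrite /diag /=; have := exit_row_ge mu x; lia. Qed.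

Lemma border_cell_inj : injective border_cell.
Proof. exact: can_inj diag_border_cell. Qed.

Lemma in_skew c :
  (c \in skew_shape la mu) = in_strip (diag c) && (c == border_cell (diag c)).
Proof.
rewrite in_fsetD !in_diagram_exit exit_row_strip.
have -> : (c == border_cell (diag c)) = (c.1 == exit_row mu (diag c)).
  apply/eqP/eqP => [{1}-> //|h]; rewrite /border_cell -h /diag.
  by case: c {h} => a b /=; congr pair => /=; lia.
by case: (in_strip _) => /=; lia.
Qed.

Lemma border_cell_in_skew x : (border_cell x \in skew_shape la mu) = in_strip x.
Proof. by rewrite in_skew diag_border_cell eqxx andbT. Qed.

Lemma included_skew : included mu la.
Proof. by move=> c; rewrite !in_diagram_exit exit_row_strip; lia. Qed.

Lemma border_cell_adj x : rook_adj (border_cell x) (border_cell (x + 1)).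
Proof.
rewrite /rook_adj /border_cell /=; have := exit_row_ge mu x.
by have := exit_row_ge mu (x + 1); rewrite (exit_rowS mu x); case: (edge mu x) => /=; lia.
Qed.

(** Cells on consecutive diagonals of the border are adjacent. The statement is
    about an arbitrary set [A] because it serves both for the skew shape and for
    a single piece. *)
Lemma border_connect (A : {fset cell}) (x y : A) :
  val x = border_cell (diag (val x)) -> val y = border_cell (diag (val y)) ->
  (forall z, diag (val x) <= z <= diag (val y) \/ diag (val y) <= z <= diag (val x) ->
     border_cell z \in A) ->
  connect (@rook_rel A) x y.
Proof.
wlog : x y / diag (val x) <= diag (val y) => [hw hx hy hA|hxy].
  case/orP: (le_total (diag (val x)) (diag (val y))) => h; first exact: hw.
  by rewrite rook_rel_sym; apply: hw => // z [] hz; apply: hA; auto.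
move: {2}(absz _) (erefl (absz (diag (val y) - diag (val x)))) => m.
elim: m y hxy => [|m IH] y hxy em hx hy hA.
  have -> // : x = y.
  by apply: val_inj; rewrite hx hy; congr border_cell; lia.
have hz : border_cell (diag (val y) - 1) \in A by apply: hA; lia.
pose z : A := [` hz]%fset.
have dz : diag (val z) = diag (val y) - 1 by rewrite /= diag_border_cell.
apply: (@connect_trans _ _ z).
  apply: IH; rewrite ?dz //; try lia.
  by move=> t ht; apply: hA; lia.
apply: connect1; rewrite /rook_rel hy -[X in border_cell X](subrK 1).
exact: border_cell_adj.
Qed.

Definition piece (k : int) : {fset cell} :=
  [fset c in skew_shape la mu | strip_index (diag c) == k]%fset.

Lemma in_piece k c : (c \in piece k) =
  (c \in skew_shape la mu) && (strip_index (diag c) == k).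
Proof. by rewrite /piece !inE. Qed.

Lemma border_cell_in_piece k x : lo <= k < hi ->
  (border_cell x \in piece k) = (r + n%:Z * k <= x < s + n%:Z * k).
Proof.
move=> hk; rewrite in_piece border_cell_in_skew diag_border_cell.
apply/andP/idP => [[/andP[_ h] /eqP ek]|h].
  by have := strip_index_bounds x; move: h; rewrite ek; lia.
split; first by apply/in_stripP; exists k.
by apply/eqP/strip_indexP; lia.
Qed.

Lemma pieceP k c : lo <= k < hi ->
  reflect (exists2 x, r + n%:Z * k <= x < s + n%:Z * k & c = border_cell x)
          (c \in piece k).
Proof.
move=> hk; apply: (iffP idP) => [hc|[x hx ->]]; last by rewrite border_cell_in_piece.
have ec : c = border_cell (diag c).
  by move: hc; rewrite in_piece in_skew => /andP[/andP[_ /eqP]].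
by exists (diag c) => //; rewrite -border_cell_in_piece // -ec.
Qed.

Lemma piece_index k c : lo <= k < hi -> c \in piece k ->
  r + n%:Z * k <= diag c < s + n%:Z * k.
Proof. by move=> hk /pieceP - /(_ hk) [x hx ->]; rewrite diag_border_cell. Qed.

(** Adjacent cells lie on consecutive diagonals, while distinct strips are
    separated by at least one diagonal since [s - r < n]. *)
Lemma skew_index_adj c c' : c \in skew_shape la mu -> c' \in skew_shape la mu ->
  rook_adj c c' -> strip_index (diag c) = strip_index (diag c').
Proof.
rewrite !in_skew => /andP[/andP[_ h] _] /andP[/andP[_ h'] _] /rook_adj_diag hadj.
have b := strip_index_bounds (diag c); have b' := strip_index_bounds (diag c').
by apply: (mulz_near n); lia.
Qed.

Lemma skew_connect_index (x y : skew_shape la mu) :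
  connect (@rook_rel _) x y = (strip_index (diag (val x)) == strip_index (diag (val y))).
Proof.
apply/idP/eqP => [/connectP[p + ->]|e].
  elim: p x => [|z p IH] x //= /andP[hxz /IH <-].
  by apply: skew_index_adj => //; apply: valP.
have := valP x; have := valP y; rewrite !in_skew => /andP[hy /eqP ey] /andP[hx /eqP ex].
apply: border_connect => // z hz; rewrite border_cell_in_skew.
move: hx hy hz; have := strip_index_bounds (diag (val x)).
have := strip_index_bounds (diag (val y)); rewrite /in_strip -e.
set k := strip_index _ => b1 b2 /andP[hk h1] /andP[_ h2] hz.
by apply/in_stripP; exists k => //; lia.
Qed.

Lemma componentsP C : C \in components (skew_shape la mu) <->
  exists2 k, lo <= k < hi & C = piece k.
Proof.
have cE (x : skew_shape la mu) :
    [fset val y | y : skew_shape la mu & connect (@rook_rel _) x y]%fset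
    = piece (strip_index (diag (val x))).
  apply/fsetP => c; rewrite in_piece; apply/imfsetP/andP => /= [[y + ->]|[hc /eqP e]].
    by rewrite inE skew_connect_index => /eqP <-; split=> //; apply: valP.
  by exists [` hc]%fset => //; rewrite inE skew_connect_index /= e.
split=> [/imfsetP /= [x _ ->]|[k hk ->]].
  rewrite cE; exists (strip_index (diag (val x))) => //.
  by have := valP x; rewrite in_skew => /andP[/andP[]].
have hx : border_cell (r + n%:Z * k) \in skew_shape la mu.
  by rewrite border_cell_in_skew; apply/in_stripP; exists k => //; lia.
apply/imfsetP; exists [` hx]%fset => //=; rewrite cE /= diag_border_cell.
by congr piece; symmetry; apply: strip_indexP; lia.
Qed.

Lemma piece_inj k k' : lo <= k < hi -> lo <= k' < hi -> piece k = piece k' -> k = k'.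
Proof.
move=> hk hk' e; have : border_cell (r + n%:Z * k) \in piece k'.
  by rewrite -e border_cell_in_piece //; lia.
by rewrite border_cell_in_piece // => h; apply: (mulz_near n); lia.
Qed.

Lemma card_components : (#|` components (skew_shape la mu)|%N)%:Z = hi - lo.
Proof.
have -> : components (skew_shape la mu) =
    [fset piece (lo + i%:Z) | i in iota 0 (absz (hi - lo))]%fset.
  apply/fsetP => C; apply/idP/imfsetP => /= [/componentsP[k hk ->]|[i]].
    exists (absz (k - lo)); first by rewrite mem_iota; lia.
    by congr piece; lia.
  rewrite mem_iota => hi' ->; apply/componentsP; exists (lo + i%:Z) => //; lia.
rewrite card_fset_iota; first by lia.
by move=> i j hi' hj /piece_inj; lia.
Qed.

Lemma card_piece k : lo <= k < hi -> (#|` piece k|%N)%:Z = s - r.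
Proof.
move=> hk; have -> : piece k =
    [fset border_cell (r + n%:Z * k + i%:Z) | i in iota 0 (absz (s - r))]%fset.
  apply/fsetP => c; apply/(pieceP _ _ hk)/imfsetP => /= [[x hx ->]|[i]].
    exists (absz (x - r - n%:Z * k)%R); first by rewrite mem_iota; lia.
    by congr border_cell; lia.
  by rewrite mem_iota => hi' ->; eexists; last reflexivity; lia.
rewrite card_fset_iota; first by lia.
by move=> i j _ _ /border_cell_inj; lia.
Qed.

(** Along the border, rows decrease and columns increase; the column of
    [border_cell x] is the second expression. *)
Lemma exit_row_mono x y : x <= y ->
  (exit_row mu y <= exit_row mu x)%N /\
  (exit_row mu x)%:Z + x <= (exit_row mu y)%:Z + y.
Proof.
move=> hxy; have -> : y = x + (absz (y - x))%:Z by lia.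
elim: (absz _) => [|m IH]; first by rewrite addr0.
have := exit_rowS mu (x + m%:Z); have -> : x + m%:Z + 1 = x + m.+1%:Z by lia.
by case: (edge mu _); lia.
Qed.

Lemma head_piece k h : lo <= k < hi ->
  is_head (piece k) h <-> h = border_cell (s - 1 + n%:Z * k).
Proof.
move=> hk; have hin : border_cell (s - 1 + n%:Z * k) \in piece k.
  by rewrite border_cell_in_piece //; lia.
split=> [[hp hmax]|->].
  case/(pieceP _ _ hk): hp hmax => x hx -> /(_ _ hin) [h1 h2].
  congr border_cell; suff : s - 1 + n%:Z * k <= x by lia.
  have := diag_border_cell (s - 1 + n%:Z * k); have := diag_border_cell x.
  by move: h1 h2; rewrite /diag /=; lia.
split=> // c /(pieceP _ _ hk) [x hx ->].
have [] := exit_row_mono x (s - 1 + n%:Z * k); first by lia.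
by move=> h1 h2 /=; split=> //; have := exit_row_ge mu x; lia.
Qed.

(** The steps of [mu] strictly inside two strips agree, so the border cells of
    both strips follow the same path up to translation. *)
Lemma piece_rows k k' m : lo <= k < hi -> lo <= k' < hi -> m%:Z < s - r ->
  (exit_row mu (r + n%:Z * k + m%:Z))%:Z - (exit_row mu (r + n%:Z * k))%:Z =
  (exit_row mu (r + n%:Z * k' + m%:Z))%:Z - (exit_row mu (r + n%:Z * k'))%:Z.
Proof.
move=> hk hk'; elim: m => [|m IH] hm; first by rewrite !addr0 !subrr.
have e j : r + n%:Z * j + m.+1%:Z = r + n%:Z * j + m%:Z + 1 by lia.
have := edge_between (r + m%:Z + 1) k k' ltac:(lia) hk hk'.
have e' j : r + m%:Z + 1 - 1 + n%:Z * j = r + n%:Z * j + m%:Z by lia.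
rewrite !e !e' => ee.
have := exit_rowS mu (r + n%:Z * k + m%:Z); have := exit_rowS mu (r + n%:Z * k' + m%:Z).
by rewrite ee; have := IH ltac:(lia); lia.
Qed.

Lemma translates_piece k k' : lo <= k < hi -> lo <= k' < hi ->
  translates (piece k) (piece k').
Proof.
pose a j j' := (exit_row mu (r + n%:Z * j'))%:Z - (exit_row mu (r + n%:Z * j))%:Z.
have shift j j' x y : lo <= j < hi -> lo <= j' < hi -> occupies (piece j) x y ->
    occupies (piece j') (x + a j j') (y + (a j j' + n%:Z * (j' - j))).
  move=> hj hj' [c /(pieceP _ _ hj) [z hz ->] [-> ->]].
  exists (border_cell (z + n%:Z * (j' - j))).
    by rewrite border_cell_in_piece //; lia.
  have := piece_rows j j' (absz (z - r - n%:Z * j)%R) hj hj' ltac:(lia).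
  have -> : r + n%:Z * j + (absz (z - r - n%:Z * j)%R)%:Z = z by lia.
  have -> : r + n%:Z * j' + (absz (z - r - n%:Z * j)%R)%:Z = z + n%:Z * (j' - j) by lia.
  have := exit_row_ge mu z; have := exit_row_ge mu (z + n%:Z * (j' - j)).
  by rewrite /a /=; lia.
move=> hk hk'; exists (a k k'), (a k k' + n%:Z * (k' - k)) => x y.
split; first exact: shift.
move=> /(shift k' k _ _ hk' hk).
have -> : x + a k k' + a k' k = x by rewrite /a; lia.
have -> // : y + (a k k' + n%:Z * (k' - k)) + (a k' k + n%:Z * (k - k')) = y.
by rewrite /a; lia.
Qed.

Lemma ribbon_piece k : lo <= k < hi -> ribbon (piece k).
Proof.
move=> hk; have hin c : c \in piece k -> c = border_cell (diag c).
  by rewrite in_piece in_skew => /andP[/andP[_ /eqP]].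
split.
- apply: (@skew_diagram_adj_closed la mu) => [|c|c c']; first exact: included_skew.
    by rewrite in_piece => /andP[].
  rewrite !in_piece => /andP[hc /eqP <-] hc' hcc'.
  by rewrite hc' -(skew_index_adj c c') //= eqxx.
- move=> x y; apply: border_connect; [exact/hin/valP|exact/hin/valP|move=> z hz].
  rewrite border_cell_in_piece //.
  have := piece_index k _ hk (valP x); have := piece_index k _ hk (valP y).
  by move: hz; lia.
- by move=> c c' /hin ec /hin ec' e; rewrite ec ec' e.
Qed.

Lemma strips_components :
  [/\ included mu la /\
      (forall C : {fset cell}, C \in components (skew_shape la mu) ->
         [/\ ribbon C, (#|` C|%N)%:Z = s - r,
             forall c, c \in C ->
               exists2 m : int, r <= m < s & (diag c = m %[mod n])%Z
           & forall m : int, r <= m < s ->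
               exists2 c, c \in C & (diag c = m %[mod n])%Z]),
      {in components (skew_shape la mu) &, forall C C' : {fset cell}, translates C C'} /\
      consecutive_in_class n (s - 1) #|` components (skew_shape la mu)|%N
        (fun x : int => exists C h,
           [/\ C \in components (skew_shape la mu), is_head C h & diag h = x])
    & (#|` components (skew_shape la mu)|%N)%:Z = hi - lo].
Proof.
have shift x k : (x + n%:Z * k = x %[mod n])%Z.
  by apply/eqP; rewrite eqmodz_shift.
split; [split; first exact: included_skew|split|exact: card_components].
- move=> C /componentsP[k hk ->]; split.
  + exact: ribbon_piece.
  + exact: card_piece.
  + move=> c /(piece_index _ _ hk) hc; exists (diag c - n%:Z * k); first by lia.
    by rewrite -mulrN shift.
  + move=> m hm; exists (border_cell (m + n%:Z * k)).
      by rewrite border_cell_in_piece //; lia.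
    by rewrite diag_border_cell shift.
- by move=> C C' /componentsP[k hk ->] /componentsP[k' hk' ->]; apply: translates_piece.
exists (s - 1 + n%:Z * lo) => [|x]; first exact: shift.
have := card_components; set m := #|` _|%N => hm; split.
  case=> C [h [/componentsP[k hk ->] /(head_piece _ _ hk) -> <-]].
  by exists (absz (k - lo)); [lia | rewrite diag_border_cell; nia].
case=> k hk ->; exists (piece (lo + k%:Z)), (border_cell (s - 1 + n%:Z * (lo + k%:Z))).
have hk' : lo <= lo + k%:Z < hi by lia.
split; [by apply/componentsP; exists (lo + k%:Z) | exact/head_piece|].
by rewrite diag_border_cell; lia.
Qed.

End Strips.

Theorem proposition9p5 (n : nat) (mu la : intpart) (r s : int) (d : int -> int)
    (n_ge2 : (2 <= n)%N) (core_mu : n_core n mu) (core_la : n_core n la)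
    (mu_la : core_cover n mu la)
    (rs_mod : (r != s %[mod n])%Z) (r_gt0 : 0 < r) (r_lt_s : r < s)
    (rs_act : acts n (reflection n r s) mu la)
    (d_offset : extended_offset n mu d) :
  [/\ s - r < n%:Z,
      included mu la /\
      (forall C : {fset cell}, C \in components (skew_shape la mu) ->
         [/\ ribbon C, (#|` C|%N)%:Z = s - r,
             forall c, c \in C ->
               exists2 m : int, r <= m < s & (diag c = m %[mod n])%Z
           & forall m : int, r <= m < s ->
               exists2 c, c \in C & (diag c = m %[mod n])%Z]),
      {in components (skew_shape la mu) &, forall C C' : {fset cell}, translates C C'} /\
      consecutive_in_class n (s - 1) #|` components (skew_shape la mu)|%N
        (fun x : int => exists C h,
           [/\ C \in components (skew_shape la mu), is_head C h & diag h = x])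
    & (#|` components (skew_shape la mu)|%N)%:Z = d r - d s].
Proof.
have [s_r_lt_n ds_dr gap edge_mu] :=
  cover_offsets _ _ _ _ _ _ n_ge2 mu_la rs_mod r_lt_s rs_act d_offset.
have n_gt0 : (0 < n)%N by lia.
have edge_la x : edge la (reflection n r s x - 1) = edge mu (x - 1).
  exact: (edge_acts n _ mu).
have at_r k : r - 1 + n%:Z * k = r + n%:Z * k - 1 by lia.
have at_s k : s - 1 + n%:Z * k = s + n%:Z * k - 1 by lia.
have la_r k : edge la (r - 1 + n%:Z * k) = (k < d s).
  by rewrite at_r -(reflection_right n r s) // edge_la -at_s edge_mu.
have la_s k : edge la (s - 1 + n%:Z * k) = (k < d r).
  by rewrite at_s -(reflection_left n r s) edge_la -at_r edge_mu.
have edge_r k : d s <= k < d r ->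
    edge mu (r - 1 + n%:Z * k) /\ ~~ edge la (r - 1 + n%:Z * k).
  by move=> hk; rewrite edge_mu la_r; lia.
have edge_s k : d s <= k < d r ->
    ~~ edge mu (s - 1 + n%:Z * k) /\ edge la (s - 1 + n%:Z * k).
  by move=> hk; rewrite edge_mu la_s; lia.
have edge_other x :
    (forall k, d s <= k < d r -> x <> r - 1 + n%:Z * k) ->
    (forall k, d s <= k < d r -> x <> s - 1 + n%:Z * k) -> edge la x = edge mu x.
  move=> hr hs.
  have [/eqmodzP[k hk]|hxr] := boolP (x + 1 == r %[mod n])%Z.
    have ex : x = r - 1 + n%:Z * k by lia.
    by have := hr k; rewrite ex edge_mu la_r; lia.
  have [/eqmodzP[k hk]|hxs] := boolP (x + 1 == s %[mod n])%Z.
    have ex : x = s - 1 + n%:Z * k by lia.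
    by have := hs k; rewrite ex edge_mu la_s; lia.
  by have := edge_la (x + 1); rewrite reflection_fix // addrK.
have edge_between i k k' : r < i < s -> d s <= k < d r -> d s <= k' < d r ->
    edge mu (i - 1 + n%:Z * k) = edge mu (i - 1 + n%:Z * k').
  by move=> hi hk hk'; rewrite !edge_mu; case: (gap i hi); lia.
by have [] := strips_components n mu la r s (d s) (d r) n_gt0 r_lt_s s_r_lt_n
  ds_dr edge_r edge_s edge_other edge_between.
Qed.
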